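(* For every $k\ge 1$, \[\varepsilon_{k+1,2}=\sum_{i=0}^{\varepsilon_{k,2}-1}2^i=2^{\varepsilon_{k,2}}-1.\]
   Context: For a base $b\ge 2$, every $a\in\mathbb{Z}^+$ has a base $b$ expansion $a=\sum_{i=0}^n a_ib^i$ with $0\le a_i<b$ and leading digit $a_n\ne 0$. The $b$-elated function $E_{2,b}:\mathbb{Z}^+\to\mathbb{Z}^+$ is defined by $E_{2,b}(a)=a_n\sum_{i=0}^n a_i^2$. A $b$-elated number is an $a\in\mathbb{Z}^+$ with $E_{2,b}^m(a)=1$ for some $m\ge 0$ (iteration); its height is the smallest such $m$. $\varepsilon_{k,b}$ denotes the smallest $b$-elated number of height $k$. *)

(* Defs.v *)
From mathcomp Require Import all_boot.

Set Implicit Arguments.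
Unset Strict Implicit.
Unset Printing Implicit Defensive.

Definition digit (b a i : nat) : nat := (a %/ b ^ i) %% b.

(* For 2 <= b and 0 < a this is the n with b ^ n <= a < b ^ n.+1, i.e. the
   index of the leading base b digit of a; see [digit_expansion]. *)
Definition lead_index (b a : nat) : nat := trunc_log b a.

Definition elated_fun (b a : nat) : nat :=
  digit b a (lead_index b a) *
    \sum_(i < (lead_index b a).+1) digit b a i ^ 2.

Definition elated (b a : nat) : Prop :=
  0 < a /\ exists m : nat, iter m (elated_fun b) a = 1.

Definition elated_height (b a m : nat) : Prop :=
  iter m (elated_fun b) a = 1 /\
  forall m' : nat, iter m' (elated_fun b) a = 1 -> m <= m'.

(* [smallest_elated b k e] is the graph of the partial function epsilon_{k,b};
   functionality is [smallest_elated_uniq]. *)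
Definition smallest_elated (b k e : nat) : Prop :=
  [/\ elated b e, elated_height b e k &
      forall a : nat, elated b a -> elated_height b a k -> e <= a].

Lemma smallest_elated_uniq (b k e e' : nat) :
  smallest_elated b k e -> smallest_elated b k e' -> e = e'.
Proof.
move=> [He hk He_min] [He' hk' He'_min]; apply/eqP.
by rewrite eqn_leq He_min ?He'_min.
Qed.

Lemma digit_partial_sum (b a n : nat) : 0 < b ->
  a = \sum_(i < n) digit b a i * b ^ i + a %/ b ^ n * b ^ n.
Proof.
move=> b_gt0; elim: n => [|n IHn]; first by rewrite big_ord0 divn1 muln1.
rewrite {1}IHn big_ord_recr /= -addnA; congr (_ + _).
by rewrite expnSr divnMA mulnA mulnAC -mulnDl addnC -divn_eq.
Qed.

Lemma digit_expansion (b a : nat) : 1 < b -> 0 < a ->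
  [/\ a = \sum_(i < (lead_index b a).+1) digit b a i * b ^ i,
      forall i, digit b a i < b & digit b a (lead_index b a) != 0].
Proof.
move=> b_gt1 a_gt0; have b_gt0 := ltnW b_gt1.
have /andP[le_a lt_a] := trunc_log_bounds b_gt1 a_gt0.
split=> [|i|]; last 2 first.
- by rewrite ltn_mod.
- rewrite /digit modn_small; last by rewrite ltn_divLR ?expn_gt0 ?b_gt0 // -expnS.
  by rewrite -lt0n divn_gt0 ?expn_gt0 ?b_gt0.
by rewrite {1}(digit_partial_sum a (lead_index b a).+1 b_gt0) divn_small ?addn0.
Qed.

(* Main.v *)
Require Import Defs.
From mathcomp Require Import all_boot.

(** A leading binary digit is 1 and a bit is its own square, so in base 2 the
    elated function is the number of ones in the binary expansion.  A number
    with [s] ones is at least [2 ^ s - 1], with equality for [s] consecutive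
    ones ([expn_sum_bits_le], [elated_fun_pow2_pred]); thus, among numbers whose
    image is at least [e], the least is [2 ^ e - 1], and its image is [e].

    Height drops by exactly one along the map, except at the fixed point 1.
    A number of height [k.+1] has an image of height [k], which is at least the
    smallest such number [e], so the number itself is at least [2 ^ e - 1].
    Conversely [2 ^ e - 1] has height [k.+1] unless it is 1, and this exception
    is where [1 <= k] enters: it forces [2 <= e].  The recursion
    ([smallest_elated_pow2_pred]) therefore starts from the number 2, the
    smallest one of height 1. *)

Lemma elated_height_image {b a k : nat} :
  elated_height b a k.+1 -> elated_height b (elated_fun b a) k.
Proof.
move=> [iter_a min_k]; split=> [|m]; first by rewrite -iterSr.
by rewrite -iterSr => /min_k.
Qed.

Lemma elated_height_preimage {b a k : nat} : a != 1 ->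
  elated_height b (elated_fun b a) k -> elated_height b a k.+1.
Proof.
move=> a_neq1 [iter_a min_k]; split=> [|[|m]]; first by rewrite iterSr.
  by move=> /= a1; rewrite a1 in a_neq1.
by rewrite iterSr => /min_k.
Qed.

Lemma elated_height_gt1 {b a k : nat} :
  0 < a -> elated_height b a k.+1 -> 1 < a.
Proof.
by case: a => [|[|a]] // _ [_ min_k]; have := min_k 0 erefl.
Qed.

Lemma elated_fun_gt0 (b a : nat) : 1 < b -> 0 < a -> 0 < elated_fun b a.
Proof.
move=> b_gt1 a_gt0; have [_ _] := digit_expansion b_gt1 a_gt0.
rewrite -lt0n /elated_fun big_ord_recr /= => lead_gt0.
by rewrite muln_gt0 lead_gt0 addn_gt0 expn_gt0 lead_gt0 orbT.
Qed.

Lemma elated_fun2E (a : nat) : 0 < a ->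
  elated_fun 2 a = \sum_(i < (lead_index 2 a).+1) digit 2 a i.
Proof.
move=> a_gt0; have [_ bitP lead_neq0] := digit_expansion (ltnSn 1) a_gt0.
have lead1 : digit 2 a (lead_index 2 a) = 1.
  by case: (digit _ _ _) (bitP (lead_index 2 a)) lead_neq0 => [|[]].
rewrite /elated_fun lead1 mul1n; apply: eq_bigr => i _.
by case: (digit 2 a i) (bitP i) => [|[]].
Qed.

(** A new top bit of weight [2 ^ n] doubles the left-hand side, which so far is
    at most [2 ^ n]: hence it adds at least as much on the right. *)
Lemma expn_sum_bits_le (d : nat -> nat) (n : nat) : (forall i, d i < 2) ->
  2 ^ (\sum_(i < n) d i) <= (\sum_(i < n) d i * 2 ^ i).+1.
Proof.
move=> bitP; elim: n => [|n IHn]; first by rewrite !big_ord0.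
rewrite !big_ord_recr /=.
case: (d n) (bitP n) => [|[|//]] _; first by rewrite addn0 mul0n addn0.
rewrite addn1 expnS mul2n -addnn mul1n -addSn leq_add // leq_exp2l //.
rewrite -[leqRHS]card_ord -sum1_card; apply: leq_sum => i _.
by rewrite -ltnS bitP.
Qed.

Lemma expn_elated_fun2_le {a : nat} : 0 < a -> 2 ^ elated_fun 2 a <= a.+1.
Proof.
move=> a_gt0; have [a_eq bitP _] := digit_expansion (ltnSn 1) a_gt0.
rewrite elated_fun2E // [in leqRHS]a_eq; exact: expn_sum_bits_le.
Qed.

Lemma digit_pow2_pred {e i : nat} : i < e -> digit 2 (2 ^ e - 1) i = 1.
Proof.
move=> lt_ie; rewrite /digit.
(* Shifting out the [i] lowest ones leaves [2 ^ (e - i) - 1], an odd number. *)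
have -> : 2 ^ e - 1 = (2 ^ (e - i) - 1) * 2 ^ i + (2 ^ i - 1).
  rewrite mulnBl mul1n -expnD subnK 1?ltnW // addnBA ?expn_gt0 //.
  by rewrite subnK // leq_exp2l // ltnW.
rewrite divnMDl ?expn_gt0 // divn_small; last first.
  by rewrite subn1 ltn_predL expn_gt0.
by rewrite addn0 modn2 oddB ?expn_gt0 // oddX subn_eq0 leqNgt lt_ie.
Qed.

Lemma elated_fun_pow2_pred (e : nat) : 0 < e -> elated_fun 2 (2 ^ e - 1) = e.
Proof.
case: e => // e _.
have lead : lead_index 2 (2 ^ e.+1 - 1) = e.
  apply: trunc_log_eq => //; rewrite subn1 ltn_predL expn_gt0 andbT.
  by rewrite -ltnS prednK ?expn_gt0 // ltn_exp2l.
rewrite elated_fun2E; last by rewrite subn_gt0 -{1}(expn0 2) ltn_exp2l.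
rewrite lead (eq_bigr (fun=> 1)) => [|i _]; last exact: digit_pow2_pred.
by rewrite sum1_card card_ord.
Qed.

Lemma smallest_elated_pow2_pred {k e : nat} : 1 < e ->
  smallest_elated 2 k e -> smallest_elated 2 k.+1 (2 ^ e - 1).
Proof.
move=> e_gt1 [[e_gt0 _] height_e min_e].
have pred_gt1 : 1 < 2 ^ e - 1.
  by rewrite ltn_subRL; exact: leq_ltn_trans e_gt1 (ltn_expl e _).
have height_pred : elated_height 2 (2 ^ e - 1) k.+1.
  by apply: elated_height_preimage; rewrite ?elated_fun_pow2_pred // gtn_eqF.
split=> // [|a [a_gt0 _] height_a].
  by split; [exact: ltnW | exists k.+1; case: height_pred].
have height_Ea := elated_height_image height_a.
have le_e : e <= elated_fun 2 a.
  apply: min_e => //; split; first exact: elated_fun_gt0.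
  by exists k; case: height_Ea.
rewrite leq_subLR add1n; apply: leq_trans _ (expn_elated_fun2_le a_gt0).
by rewrite leq_exp2l.
Qed.

Lemma smallest_elated2_1 : smallest_elated 2 1 2.
Proof.
have E2 : elated_fun 2 2 = 1.
  by rewrite /elated_fun /lead_index !big_ord_recr big_ord0.
split; first by split=> //; exists 1.
  by apply: elated_height_preimage => //; rewrite E2; split.
by move=> a [a_gt0 _]; exact: elated_height_gt1.
Qed.

Lemma smallest_elated2_exists (k : nat) : exists e, smallest_elated 2 k.+1 e.
Proof.
elim: k => [|k [e eP]]; first by exists 2; exact: smallest_elated2_1.
have [[e_gt0 _] height_e _] := eP.
exists (2 ^ e - 1); apply: smallest_elated_pow2_pred eP.
exact: elated_height_gt1 height_e.
Qed.

Theorem theorem11 (k : nat) (hk : 1 <= k) :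
  exists e e' : nat,
    [/\ smallest_elated 2 k e,
        smallest_elated 2 k.+1 e',
        e' = \sum_(0 <= i < e) 2 ^ i &
        \sum_(0 <= i < e) 2 ^ i = 2 ^ e - 1].
Proof.
case: k hk => // k _; have [e eP] := smallest_elated2_exists k.
have geom : \sum_(0 <= i < e) 2 ^ i = 2 ^ e - 1.
  by rewrite big_mkord subn1 predn_exp mul1n.
have [[e_gt0 _] height_e _] := eP.
exists e, (2 ^ e - 1); split=> //; apply: smallest_elated_pow2_pred eP.
exact: elated_height_gt1 height_e.
Qed.
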